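(* Suppose $(d_n)_{n\in\mathbb{N}}$ is a sequence of integers with $d_n\ge 3$ and suppose $(c_n)_{n\in\mathbb{N}}$ is a sequence of integers going to infinity. Let $G_n$ be a finite $d_n$-regular graph with girth $c_n$. Then the disjoint union $\coprod_{n\in\mathbb{N}}G_n$ fails to have property A.
   Context: Graphs have no self-loops and no multiple edges; each edge is given one orientation, but degree, girth and the path-length metric are those of the underlying undirected graph. The girth is the length of a shortest cycle. In the path-length metric the distance between two vertices is the number of edges of a shortest undirected path, and is $\infty$ if they lie in different components. $B(i,S)$ is the closed ball of radius $S$ about $i$. For a (possibly infinite) graph $G=(V,E)$ and an integer $S\ge0$, $\varepsilon_{S,G}$ is the minimal $\varepsilon\ge0$ for which there is a family of functions $\{\xi_i\colon V\to\mathbb{R}\}_{i\in V}$ with $\xi_i\ge 0$, $\|\xi_i\|_1=1$ and $\{j\in V:\xi_i(j)>0\}\subset B(i,S)$ for each $i\in V$, and $\|\xi_i-\xi_j\|_1\le\varepsilon$ for each $ij\in E$. The graph $G$ has property A iff $\lim_{S\to\infty}\varepsilon_{S,G}=0$. *)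

(* Defs.v *)
From HB Require Import structures.
From mathcomp Require Import all_boot all_order all_algebra.
From mathcomp Require Import all_classical all_reals all_analysis.

Set Implicit Arguments.
Unset Strict Implicit.
Unset Printing Implicit Defensive.

Import Order.TTheory GRing.Theory Num.Theory.
Import numFieldNormedType.Exports.

Local Open Scope classical_set_scope.
Local Open Scope ring_scope.

(* Possibly infinite simple graphs.  Degree, girth, the path metric and the
   condition defining property A are insensitive to the choice of an
   orientation of each edge (the last one because the l1 distance is
   symmetric), so only the underlying symmetric adjacency is recorded. *)
Record graph := Graph {
  vertex :> choiceType;
  adj : rel vertex;
  adj_sym : symmetric adj;
  adj_irr : irreflexive adj }.

Definition finite_graph (G : graph) : Prop := finite_set [set: G].

Definition regular (d : nat) (G : graph) : Prop :=
  forall i : G, ([set j | adj i j] #= `I_d)%card.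

(* Three vertices at least: by symmetry of adj, every edge gives a [ucycle]
   of size 2. *)
Definition graph_cycle (G : graph) (p : seq G) : Prop :=
  ucycle (@adj G) p /\ (3 <= size p)%N.

(* A graph without cycles (infinite girth) has no c with [has_girth c G]. *)
Definition has_girth (c : nat) (G : graph) : Prop :=
  (exists2 p : seq G, graph_cycle p & size p = c) /\
  (forall p : seq G, graph_cycle p -> (c <= size p)%N).

Section Coproduct.
Variables (I : choiceType) (G : I -> graph).

Definition coprod_adj : rel {n : I & vertex (G n)} :=
  fun u v => (tag u == tag v) && adj (tagged u) (tagged_as u v).

Lemma coprod_adj_sym : symmetric coprod_adj.
Proof.
move=> [m x] [n y]; rewrite /coprod_adj /= eq_sym; case: eqP => //= nm.
by subst n; rewrite !tagged_asE adj_sym.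
Qed.

Lemma coprod_adj_irr : irreflexive coprod_adj.
Proof. by move=> [m x]; rewrite /coprod_adj /= eqxx tagged_asE adj_irr. Qed.

Definition coprod_graph : graph := Graph coprod_adj_sym coprod_adj_irr.

End Coproduct.

Section PropertyA.
Variables (R : realType) (G : graph).
Implicit Types (i j : G) (S : nat).

(* The edge sequence of a path i :: p has length size p; the infimum of the
   empty set is +oo, for vertices in different components. *)
Definition gdist i j : \bar R :=
  ereal_inf [set (size p)%:R%:E | p in
    [set p : seq G | [/\ path (@adj G) i p, uniq (i :: p) & last i p = j]]].

Definition gball i S : set G := [set j | (gdist i j <= S%:R%:E)%E].

Definition norm1 (f : G -> R) : \bar R := (\esum_(j in [set: G]) `|f j|%:E)%E.

Definition admissible S (e : R) (xi : G -> G -> R) : Prop :=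
  [/\ forall i j, 0 <= xi i j,
      forall i, norm1 (xi i) = 1%E,
      forall i, [set j | 0 < xi i j] `<=` gball i S &
      forall i j, adj i j -> (norm1 (fun k => xi i k - xi j k)%R <= e%:E)%E].

Definition admissible_eps S : set R :=
  [set e | 0 <= e /\ exists xi, admissible S e xi].

(* The least admissible value; the infimum is over a nonempty set
   ([admissible_eps2]) bounded below by 0, so it is never a default value. *)
Definition eps S : R := inf (admissible_eps S).

Definition property_A : Prop := eps S @[S --> \oo] --> (0 : R).

Lemma norm1_dirac i : norm1 (fun k => (k == i)%:R) = 1%E.
Proof.
transitivity (\esum_(k in [set i]) `|(k == i)%:R|%:E : \bar R)%E.
  rewrite [RHS]esum_mkcond; apply: eq_esum => k _.
  case: ifPn => //; rewrite notin_setE /= => /eqP/negbTE ->.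
  by rewrite normr0.
by rewrite esum_set1 ?lee_fin// eqxx normr1.
Qed.

Lemma admissible_eps2 S : admissible_eps S 2.
Proof.
split=> //; exists (fun i k => (k == i)%:R); split => [i j|i|i j /=|i j _].
- by rewrite ler0n.
- exact: norm1_dirac.
- case: eqP => [->|_]; last by rewrite ltxx.
  move=> _; apply: (@le_trans _ _ 0%:E); last by rewrite lee_fin.
  by apply: ereal_inf_lbound; exists [::].
- apply: (@le_trans _ _ (norm1 (fun k => (k == i)%:R) +
                         norm1 (fun k => (k == j)%:R))%E).
    rewrite /norm1 -esumD; try by move=> k _; rewrite lee_fin.
    by apply: le_esum => k _; rewrite -EFinD lee_fin ler_normB.
  by rewrite !norm1_dirac -EFinD.
Qed.

End PropertyA.

(* Main.v *)
Require Import Defs.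
From mathcomp Require Import all_boot all_order all_algebra.
From mathcomp Require Import all_classical all_reals all_analysis.
From mathcomp Require Import lra.

Set Implicit Arguments.
Unset Strict Implicit.
Unset Printing Implicit Defensive.

Import Order.TTheory GRing.Theory Num.Theory.

Local Open Scope classical_set_scope.
Local Open Scope ring_scope.

(** A regular tree of degree d >= 3 is non-amenable: every finitely supported
    f >= 0 on it has l1 variation (over unordered edges) at least (d - 2) times
    its l1 norm.  Property A would make the variation small, and large girth
    makes balls look like balls in a tree; double counting confronts the two.

    Let (xi_i) be an admissible family of radius S and variation e on a finite
    d-regular graph whose cycles all have length at least 2S + 3.  The bound
    is applied not to the xi_i but to their transposes: for each vertex k, the
    function f_k(i) = xi_i(k) lives on the ball B(k, S).  If i is in B(k, S),
    at most one of its neighbours is not farther from k than i is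
    ([nonfarther_neighbor_unique]), since two of them would close up a cycle of
    length at most 2S + 2 through i.  Hence the unit flow away from k has
    divergence at least (d - 1) - 1 at every point of the ball
    ([outflow_ge]), and pairing this flow with the gradient of f_k bounds the
    variation of f_k from below by (d - 2) times its sum
    ([tree_isoperimetry]).

    Summing over k, with N the number of vertices, the sums of the f_k add up
    to the sum of the norms of the xi_i, that is N, and the variations add up
    to the sum over the dN / 2 edges ij of the norm of xi_i - xi_j, at most
    e dN / 2.  So e >= 2 (d - 2) / d >= 2/3
    ([admissible_lower_bound]).

    For every S some G_n has girth at least 2S + 3, and an admissible family on
    the disjoint union restricts to one on G_n because balls do not leave their
    component ([admissible_restrict]).  Therefore the optimal variation on the
    union is at least 2/3 at every radius. *)

(** * Geodesics in graphs of large girth *)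

Section Distance.
Variables (R : realType) (G : graph).
Implicit Types (i j k : G) (p : seq G).

Lemma gdist_le_size i p : path (@adj G) i p ->
  (gdist R i (last i p) <= (size p)%:R%:E)%E.
Proof.
case/shortenP => q pq uq qp.
apply: (@le_trans _ _ (size q)%:R%:E).
  by apply: ereal_inf_lbound; exists q.
by rewrite lee_fin ler_nat uniq_leq_size//; case/andP: uq.
Qed.

(** A finite distance is an infimum of a nonempty set of natural numbers, hence
    attained. *)
Lemma gdist_geodesic i k (S : nat) : (gdist R i k <= S%:R%:E)%E ->
  exists p, [/\ path (@adj G) i p, last i p = k & gdist R i k = (size p)%:R%:E].
Proof.
move=> ikS.
have /ereal_inf_lt[_ [p0 [pp0 _ l0] <-] _] : (gdist R i k < S.+1%:R%:E)%E.
  by rewrite (le_lt_trans ikS)// lte_fin ltr_nat.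
pose walk n := `[< exists p, [/\ path (@adj G) i p, last i p = k & size p = n] >].
have ex_walk : exists n, walk n by exists (size p0); apply/asboolP; exists p0.
case: (ex_minnP ex_walk) => m /asboolP[p [pp lp <-]] minp.
exists p; split=> //; apply/eqP; rewrite eq_le -{1}lp gdist_le_size//=.
apply: le_ereal_inf_tmp => _ [q [pq _ lq] <-]; rewrite lee_fin ler_nat.
by apply: minp; apply/asboolP; exists q.
Qed.

(** Distances to the end strictly decrease along a geodesic, so a geodesic that
    starts no farther from k than i is could only meet i at its first vertex,
    which adjacency excludes. *)
Lemma geodesic_avoids i j p k : (gdist R j k <= gdist R i k)%E ->
  path (@adj G) j p -> last j p = k -> gdist R j k = (size p)%:R%:E ->
  adj i j -> i \notin j :: p.
Proof.
move=> ji pp lp dj aij; rewrite inE negb_or; apply/andP; split.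
  by apply/eqP => ij; move: aij; rewrite ij adj_irr.
apply/negP => ip; case/splitPr: ip pp lp dj => p1 p2.
rewrite cat_path /= last_cat /= => /and3P[_ _ pp2] lp dj.
move: ji; rewrite leNgt => /negP; apply.
rewrite dj -lp (le_lt_trans (gdist_le_size pp2))// lte_fin ltr_nat.
by rewrite size_cat /= addnS ltnS leq_addl.
Qed.

(** Geodesics from j1 and j2 to k avoid i, so their concatenation contains a
    simple path of length at most 2S from j1 to j2 that avoids i; together with
    i it is a cycle with at most 2S + 2 vertices. *)
Lemma nonfarther_neighbor_unique (S : nat) i j1 j2 k :
  (forall p, graph_cycle p -> (S.*2 + 3 <= size p)%N) ->
  (gdist R i k <= S%:R%:E)%E -> adj i j1 -> adj i j2 ->
  (gdist R j1 k <= gdist R i k)%E -> (gdist R j2 k <= gdist R i k)%E ->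
  j1 = j2.
Proof.
move=> girth ikS a1 a2 d1 d2; apply/eqP/negPn/negP => j12.
have geo j : adj i j -> (gdist R j k <= gdist R i k)%E ->
    exists p, [/\ path (@adj G) j p, last j p = k, i \notin j :: p &
                  (size p <= S)%N].
  move=> aj dj; have djS := le_trans dj ikS.
  have [p [pp lp dp]] := gdist_geodesic djS.
  exists p; split=> //; first exact: (geodesic_avoids dj pp lp dp aj).
  by move: djS; rewrite dp lee_fin ler_nat.
have [p1 [pp1 l1 i1 s1]] := geo j1 a1 d1.
have [p2 [pp2 l2 i2 s2]] := geo j2 a2 d2.
(* The walk j1 :: w goes from j1 to k and then back along p2 to j2. *)
pose w := p1 ++ rev (belast j2 p2).
have pw : path (@adj G) j1 w.
  rewrite cat_path pp1 l1 -l2 rev_path.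
  by rewrite (@eq_path _ _ (@adj G))// => x y; rewrite adj_sym.
have lw : last j1 w = j2.
  rewrite last_cat l1 -l2; case: (p2) => [|x p] //=.
  by rewrite rev_cons last_rcons.
have iw : i \notin j1 :: w.
  rewrite -cat_cons mem_cat mem_rev negb_or i1 /=.
  by apply: contra i2 => /mem_belast.
have sw : (size w <= S.*2)%N.
  by rewrite size_cat size_rev size_belast -addnn leq_add.
case: (shortenP pw) lw => q pq uq qw lq.
have iq : i \notin j1 :: q.
  apply: contra iw; rewrite !inE => /orP[->//|/qw ->]; exact: orbT.
have sq : (size q <= S.*2)%N.
  by apply: leq_trans sw; rewrite uniq_leq_size//; case/andP: uq.
have q0 : (0 < size q)%N by case: (q) lq j12 => //= ->; rewrite eqxx.
have /girth : graph_cycle (i :: j1 :: q).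
  split=> //; rewrite /ucycle cons_uniq iq uq andbT /=.
  by rewrite rcons_path a1 pq lq adj_sym a2.
by rewrite /= addn3 !ltnS ltnNge sq.
Qed.

End Distance.

(** * Duality between flows and variation *)

Section Flow.
Variables (R : realFieldType) (V : eqType) (e : rel V) (s : seq V).

(** Discrete integration by parts: the gradient of f paired with an
    antisymmetric flow sg equals f paired with the divergence of sg.  Each edge
    is counted in both directions, whence the factor 2. *)
Lemma flow_le_variation (f : V -> R) (sg : V -> V -> R) :
  symmetric e -> (forall i j, sg j i = - sg i j) ->
  (forall i j, `|sg i j| <= 1) ->
  2 * (\sum_(i <- s) f i * \sum_(j <- s | e i j) sg i j) <=
  \sum_(i <- s) \sum_(j <- s | e i j) `|f i - f j|.
Proof.
move=> esym sgN sg1.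
suff -> : 2 * (\sum_(i <- s) f i * \sum_(j <- s | e i j) sg i j) =
    \sum_(i <- s) \sum_(j <- s | e i j) sg i j * (f i - f j).
  apply: ler_sum => i _; apply: ler_sum => j _.
  by rewrite (le_trans (ler_norm _))// normrM ler_piMl.
set A := (X in 2 * X).
under [RHS]eq_bigr => i _.
  under eq_bigr => j _ do rewrite mulrBr.
  rewrite sumrB.
  over.
rewrite sumrB mulr2n mulrDl !mul1r; congr (_ + _).
  apply: eq_bigr => i _; rewrite mulr_sumr.
  by apply: eq_bigr => j _; rewrite mulrC.
rewrite (exchange_big_dep xpredT)//= -sumrN; apply: eq_bigr => j _.
rewrite mulr_sumr -sumrN; apply: eq_big => [i|i _]; first by rewrite esym.
by rewrite (sgN j) mulNr opprK mulrC.
Qed.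

End Flow.

(** * Lower bound for a finite regular graph of large girth *)

Section FiniteGraph.
Variables (R : realType) (G : graph).
Hypothesis G_fin : finite_graph G.

Let s : seq G := finmap.enum_fset (fset_set [set: G]).

Lemma mem_vertices i : i \in s.
Proof. by have := in_fset_set G_fin i; rewrite in_setT. Qed.

Lemma norm1_finite (f : G -> R) : norm1 f = (\sum_(j <- s) `|f j|)%:E.
Proof.
by rewrite /norm1 esum_fset// fsbig_finite// sumEFin.
Qed.

Lemma count_adj d i : regular d G -> count (adj i) s = d.
Proof.
move=> /(_ i) /card_fset_set <-; rewrite -size_filter.
have fin : finite_set [set j | adj i j] by apply: sub_finite_set G_fin.
apply/perm_size/uniq_perm; [exact/filter_uniq/finmap.fset_uniq |
  exact: finmap.fset_uniq |].
move=> j; rewrite mem_filter mem_vertices andbT.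
have /= -> := in_fset_set fin j.
by apply/idP/idP; rewrite ?inE.
Qed.

Section Ball.
Variables (d S : nat) (k : G).
Hypothesis G_reg : regular d G.
Hypothesis girth : forall p : seq G, graph_cycle p -> (S.*2 + 3 <= size p)%N.

(** The unit flow away from k; edges between points at equal distance carry
    none. *)
Let sg (i j : G) : R :=
  (gdist R i k < gdist R j k)%E%:R - (gdist R j k < gdist R i k)%E%:R.

(** An edge leaving i carries flow 1 unless its other end is not farther from k,
    in which case it carries at least -1; there is at most one such edge. *)
Lemma outflow_ge i : (gdist R i k <= S%:R%:E)%E ->
  d%:R - 2 <= \sum_(j <- s | adj i j) sg i j.
Proof.
move=> ikS.
have few : (count (fun j => adj i j && (gdist R j k <= gdist R i k)%E) s <= 1)%N.
  rewrite -size_filter.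
  have : uniq [seq j <- s | adj i j && (gdist R j k <= gdist R i k)%E].
    exact/filter_uniq/finmap.fset_uniq.
  have : all (fun j => adj i j && (gdist R j k <= gdist R i k)%E)
      [seq j <- s | adj i j && (gdist R j k <= gdist R i k)%E].
    exact: filter_all.
  case: [seq j <- s | _] => [//|a [//|b l]] /= /and3P[/andP[aa da] /andP[ab db] _].
  by rewrite (nonfarther_neighbor_unique girth ikS aa ab da db) inE eqxx.
apply: (@le_trans _ _ (\sum_(j <- s | adj i j)
    (1 - 2 * (gdist R j k <= gdist R i k)%E%:R))); last first.
  apply: ler_sum => j _; rewrite /sg.
  by case: (ltgtP (gdist R i k) (gdist R j k)) => _ /=; lra.
rewrite sumrB -mulr_sumr big_const_seq (count_adj _ G_reg) iter_addr_0.
rewrite -natr_sum -big_mkcondr /= sum1_count lerD2l lerN2 ler_piMr//.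
by rewrite -(ler_nat R) in few.
Qed.

(** The linear isoperimetric inequality of the d-regular tree, for functions
    supported in a ball that is a tree. *)
Lemma tree_isoperimetry (f : G -> R) : (forall i, 0 <= f i) ->
  (forall i, 0 < f i -> (gdist R i k <= S%:R%:E)%E) ->
  2 * ((d%:R - 2) * \sum_(i <- s) f i) <=
  \sum_(i <- s) \sum_(j <- s | adj i j) `|f i - f j|.
Proof.
move=> f0 fS; apply: (le_trans _ (@flow_le_variation _ _ (@adj G) s f sg _ _ _)).
- rewrite ler_pM2l// mulr_sumr; apply: ler_sum => i _.
  have := f0 i; rewrite le_eqVlt => /orP[/eqP <-|fi]; first by rewrite mulr0 mul0r.
  by rewrite mulrC ler_pM2l// outflow_ge// fS.
- exact: adj_sym.
- by move=> i j; rewrite opprB.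
- by move=> i j; rewrite /sg; case: ltgtP => _ /=;
    rewrite ?subr0 ?sub0r ?normrN ?normr1 ?normr0 ?subrr ?normr0.
Qed.

End Ball.

(** Double counting of the sum over k and over ordered edges (i, j) of
    |xi_i(k) - xi_j(k)|: for fixed k it is bounded below by the isoperimetric
    inequality on B(k, S), for fixed (i, j) it is bounded above by e.  The
    vertex i0 makes the number of vertices nonzero, so that it cancels. *)
Lemma admissible_lower_bound d S (e : R) (xi : G -> G -> R) (i0 : G) : regular d G ->
  (forall p : seq G, graph_cycle p -> (S.*2 + 3 <= size p)%N) ->
  admissible S e xi -> 2 * (d%:R - 2) <= d%:R * e.
Proof.
move=> G_reg girth [xi0 xi1 xiS xie].
have n0 : 0 < (size s)%:R :> R.
  by rewrite ltr0n; have := mem_vertices i0; case: s.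
have n1 i : \sum_(k <- s) xi i k = 1.
  have [<-] : (\sum_(k <- s) `|xi i k|)%:E = 1%E by rewrite -norm1_finite.
  by apply: eq_bigr => k _; rewrite ger0_norm.
have lower : 2 * ((d%:R - 2) * (size s)%:R) <=
    \sum_(k <- s) \sum_(i <- s) \sum_(j <- s | adj i j) `|xi i k - xi j k|.
  apply: (@le_trans _ _
      (\sum_(k <- s) 2 * ((d%:R - 2) * \sum_(i <- s) xi i k))).
    rewrite -!mulr_sumr exchange_big /= (eq_bigr (fun=> 1))//.
    by rewrite big_const_seq count_predT iter_addr_0.
  apply: ler_sum => k _; apply: (tree_isoperimetry (k := k) G_reg girth) => //.
  by move=> i /(xiS i k).
have upper : \sum_(k <- s) \sum_(i <- s) \sum_(j <- s | adj i j)
    `|xi i k - xi j k| <= (size s)%:R * (d%:R * e).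
  rewrite exchange_big /=.
  apply: (@le_trans _ _ (\sum_(i <- s) d%:R * e)); last first.
    by rewrite big_const_seq count_predT iter_addr_0 -[X in X <= _]mulr_natl.
  apply: ler_sum => i _; rewrite exchange_big /=.
  apply: (@le_trans _ _ (\sum_(j <- s | adj i j) e)); last first.
    by rewrite big_const_seq (count_adj _ G_reg) iter_addr_0 mulr_natl.
  apply: ler_sum => j aij; have := xie i j aij.
  by rewrite norm1_finite lee_fin.
have := le_trans lower upper.
by rewrite mulrA [_ * (size s)%:R]mulrC ler_pM2l.
Qed.

End FiniteGraph.

(** * Restriction to a component of a disjoint union *)

Section Restriction.
Variables (R : realType) (I : choiceType) (G : I -> graph) (n : I).
Local Notation inj := (@existT I (fun m => vertex (G m)) n).

Lemma coprod_path (i : G n) (p : seq (coprod_graph G)) :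
  path (@adj (coprod_graph G)) (inj i) p ->
  exists2 q : seq (G n), path (@adj (G n)) i q & p = map inj q.
Proof.
elim: p i => [|[m x] p IHp] i /=; first by exists [::].
case/andP => /andP[/= /eqP nm]; subst m; rewrite tagged_asE => aix.
by case/IHp => q pq ->; exists (x :: q); rewrite //= aix.
Qed.

Lemma inj_coprod : injective inj.
Proof.
move=> x y xy.
exact: (@eq_from_Tagged _ (fun m => vertex (G m)) _ _ _ xy).
Qed.

Lemma gball_coprod (i : G n) S (v : coprod_graph G) :
  gball R (inj i : coprod_graph G) S v ->
  exists2 j, v = inj j & gball R i S j.
Proof.
rewrite /gball /= => vS; have [p [pp lp dp]] := gdist_geodesic vS.
have [q pq pE] := coprod_path pp.
exists (last i q); first by rewrite -lp pE last_map.
by apply: le_trans (gdist_le_size _ pq) _; rewrite -[size q](size_map inj) -pE -dp.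
Qed.

Lemma norm1_restrict_le (f : coprod_graph G -> R) :
  (norm1 (f \o inj) <= norm1 f)%E.
Proof.
rewrite /norm1 -(@reindex_esum _ _ _ _ (range inj) inj (fun v => `|f v|%:E)).
  rewrite esum_mkcond; apply: le_esum => v _.
  by case: ifP => // _; rewrite lee_fin.
by apply/inj_bij; move=> x y _ _; exact: inj_coprod.
Qed.

Lemma norm1_restrict (f : coprod_graph G -> R) :
  (forall v, f v != 0 -> range inj v) -> norm1 (f \o inj) = norm1 f.
Proof.
move=> fn.
rewrite /norm1 -(@reindex_esum _ _ _ _ (range inj) inj (fun v => `|f v|%:E)).
  rewrite esum_mkcond; apply: eq_esum => v _.
  case: ifPn => // /negP nv; apply/esym/eqP; rewrite eqe normr_eq0.
  by apply/negPn/negP => /fn ?; apply: nv; rewrite inE.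
by apply/inj_bij; move=> x y _ _; exact: inj_coprod.
Qed.

(** The ball of radius S about a point of the n-th component stays in that
    component, so no mass of xi is lost by restriction. *)
Lemma admissible_restrict S (e : R) (xi : coprod_graph G -> coprod_graph G -> R) :
  admissible S e xi -> admissible S e (fun i j : G n => xi (inj i) (inj j)).
Proof.
move=> [xi0 xi1 xiS xie]; split=> [i j|i|i j /= /xiS|i j aij].
- exact: xi0.
- rewrite -(xi1 (inj i)); apply: (@norm1_restrict (xi (inj i))) => v xiv.
  have /xiS/gball_coprod[j -> _] : 0 < xi (inj i) v by rewrite lt0r xiv xi0.
  by exists j.
- by case/gball_coprod => j' /inj_coprod ->.
- apply: le_trans (@norm1_restrict_le
    (fun v => xi (inj i) v - xi (inj j) v)) _; apply: xie.
  by rewrite /adj /= /coprod_adj /= eqxx tagged_asE.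
Qed.

End Restriction.

Theorem corollary9p2 (R : realType) (d c : nat -> nat) (G : nat -> graph)
  (d_ge3 : forall n : nat, (3 <= d n)%N)
  (c_oo : c n @[n --> \oo] --> \oo)
  (G_fin : forall n : nat, finite_graph (G n))
  (G_reg : forall n : nat, regular (d n) (G n))
  (G_girth : forall n : nat, has_girth (c n) (G n)) :
  ~ property_A R (coprod_graph G).
Proof.
have eps_ge S : 2 / 3 <= eps R (coprod_graph G) S.
  apply: lb_le_inf; first by exists 2; exact: admissible_eps2.
  move=> e [_ [xi xi_adm]].
  have [n cn] : exists n, (S.*2 + 3 <= c n)%N.
    by have /cvgnyPge/(_ (S.*2 + 3)%N)[n _ /(_ n)/= H] := c_oo; exists n; exact: H.
  have [[p [_ p3] _] girth] := G_girth n.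
  have i0 : G n by case: p p3.
  have := admissible_lower_bound (G_fin n) i0 (G_reg n)
    (fun q cq => leq_trans cn (girth q cq)) (admissible_restrict n xi_adm).
  have : 3 <= (d n)%:R :> R by rewrite (ler_nat _ 3).
  by nra.
rewrite /property_A => eps0; have pos : 0 < 2 / 3 :> R by lra.
have /cvgr0_norm_lt/(_ _ pos)[N _ /(_ N (leqnn N)) /=] := eps0.
by rewrite ltNge (le_trans (eps_ge N))// ler_norm.
Qed.
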